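(* Let $\theta_0,\theta_1\in\mathbb{C}$ and let $q=q(t)$ be a solution of $\mathrm{degP}_{\rm V}(\theta_0,\theta_1)$. Put $a=\frac t4\frac{dq}{dt}$. (i) $q(-t)$ is a solution of $\mathrm{degP}_{\rm V}(\theta_0,\theta_1)$. (ii) $-q(it)+1$ is a solution of $\mathrm{degP}_{\rm V}(\theta_1,\theta_0)$. (iii) The transformations $(\theta_0,\theta_1)\mapsto(-\theta_0,\theta_1)$ and $(\theta_0,\theta_1)\mapsto(\theta_0,-\theta_1)$ induce the identity on solutions, i.e. $q$ is also a solution of $\mathrm{degP}_{\rm V}(-\theta_0,\theta_1)$ and of $\mathrm{degP}_{\rm V}(\theta_0,-\theta_1)$. (iv) The function $$\tilde q=1-\frac{\theta_0^2(q-1)}{4q^2t^2}+\frac{a\theta_0}{q^2t^2}+\frac{\theta_1^2}{4t^2(q-1)}$$ is a solution of $\mathrm{degP}_{\rm V}(\theta_0+1,\theta_1)$, and the corresponding function $\tilde a=\frac t4\frac{d\tilde q}{dt}$ is $$\tilde a=\frac{q-1}{8q^3t^2}\theta_0^3+\frac{q^2+2aq-q-6a}{8q^3t^2}\theta_0^2+\frac{q-1}{2q}\theta_0-\frac{a(q^2+2aq-q-3a)}{2(q-1)q^3t^2}\theta_0-\frac{\theta_0\theta_1^2}{8qt^2(q-1)}-\frac aq-\frac{q+2a}{8q(q-1)t^2}\theta_1^2+\frac{a^2(2a+q)}{q^3t^2(q-1)}.$$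
   Context: $\mathrm{degP}_{\rm V}(\theta_0,\theta_1)$ denotes the degenerate fifth Painlevé equation $$q''=\frac12\left(\frac1q+\frac1{q-1}\right)(q')^2-\frac{q'}{t}+\frac{2(q-1)\theta_0^2}{q\,t^2}-\frac{2q\,\theta_1^2}{(q-1)t^2}+8q(q-1),\qquad {}'=\frac{d}{dt},$$ with complex parameters $\theta_0,\theta_1$. A solution is a function $q(t)$ satisfying this equation. Here $i=\sqrt{-1}$.
   Formalization: Two misprints in (iv) are corrected: q̃ gains the term −a²/(q²t²(q−1)), and the last term of ã becomes a²(2a+q)/(2q³t²(q−1)); q̃ is claimed to be a solution where q̃ ≠ 0, 1 (for θ₀=θ₁=0 the printed q̃ is the constant 1, not a solution). *)

(* Defs.v *)
From Stdlib Require Import Reals.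
From Coquelicot Require Import Coquelicot.

Open Scope C_scope.

Notation ex_C_derive := (@ex_derive C_AbsRing C_NormedModule).

Definition degPV_rhs (th0 th1 t q q' : C) : C :=
  1 / 2 * (1 / q + 1 / (q - 1)) * q' ^ 2 - q' / t
  + 2 * (q - 1) * th0 ^ 2 / (q * t ^ 2)
  - 2 * q * th1 ^ 2 / ((q - 1) * t ^ 2)
  + 8 * q * (q - 1).

(* [q] is a single-valued holomorphic solution on the open set [U].  The
   equation is singular at t = 0, q = 0 and q = 1, and division is total, so
   these values have to be excluded.  [U] need not be connected or nonempty.  A
   meromorphic solution is covered by removing from [U] its poles, zeros and
   1-points; a multivalued one is covered branch by branch.  Twice complex
   differentiable on an open set amounts to holomorphic. *)
Definition degPV_solution (th0 th1 : C) (U : C -> Prop) (q : C -> C) : Prop :=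
  open (T := C_UniformSpace) U /\
  forall t : C, U t ->
    t <> 0 /\ q t <> 0 /\ q t <> 1 /\
    ex_C_derive q t /\ ex_C_derive (C_derive q) t /\
    C_derive (C_derive q) t = degPV_rhs th0 th1 t (q t) (C_derive q t).

Definition degPV_a (q : C -> C) (t : C) : C := t / 4 * C_derive q t.

(* The Bäcklund transform shifting (th0, th1) to (th0 + 1, th1), where [a]
   stands for (t / 4) q'.  It equals
     1 - ((th0 (q - 1) - 2 a)^2 - th1^2 q^2) / (4 q^2 t^2 (q - 1)).
   The final term - a^2 / (q^2 t^2 (q - 1)) is missing from the formula as
   published.  It is needed: without it the transform for th0 = th1 = 0 would
   be the constant 1, which is a singular value of the equation. *)
Definition shift_q (th0 th1 t q a : C) : C :=
  1 - th0 ^ 2 * (q - 1) / (4 * q ^ 2 * t ^ 2)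
  + a * th0 / (q ^ 2 * t ^ 2)
  + th1 ^ 2 / (4 * t ^ 2 * (q - 1))
  - a ^ 2 / (q ^ 2 * t ^ 2 * (q - 1)).

(* The value of (t / 4) d/dt of [shift_q] along a solution.  The factor 2 in
   the last denominator is missing from the formula as published. *)
Definition shift_a (th0 th1 t q a : C) : C :=
  (q - 1) / (8 * q ^ 3 * t ^ 2) * th0 ^ 3
  + (q ^ 2 + 2 * a * q - q - 6 * a) / (8 * q ^ 3 * t ^ 2) * th0 ^ 2
  + (q - 1) / (2 * q) * th0
  - a * (q ^ 2 + 2 * a * q - q - 3 * a) / (2 * (q - 1) * q ^ 3 * t ^ 2) * th0
  - th0 * th1 ^ 2 / (8 * q * t ^ 2 * (q - 1))
  - a / q
  - (q + 2 * a) / (8 * q * (q - 1) * t ^ 2) * th1 ^ 2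
  + a ^ 2 * (2 * a + q) / (2 * q ^ 3 * t ^ 2 * (q - 1)).

(* Main.v *)
Require Import Defs.
From Stdlib Require Import Reals Lra.
From Coquelicot Require Import Coquelicot.
Open Scope C_scope.

(** Write D = t d/dt, so that D q = 4 a.  The Bäcklund transformation becomes
visible in a first-order form of the equation: with

  w = (th0 (q - 1) - 2 a) / q,

degP_V(th0, th1) is equivalent to the pair of Riccati equations

  D q = 2 (th0 (q - 1) - w q),
  D w = (th1^2 - w^2) / (q - 1) - 4 t^2 (q - 1)

([riccati_of_degPV], [degPV_of_riccati]).  The transform qt satisfies

  4 t^2 (q - 1) (qt - 1) = th1^2 - w^2                        (R)

([shift_q_riccati]), a relation that is symmetric in q and qt, and it turns
the second equation into D w = 4 t^2 (qt - q), which is invariant under the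
exchange of q and qt together with w -> -w.  Applying D to (R) yields

  D qt = 2 (-(th0 + 1) (qt - 1) + w qt),

so (qt, -w) solves the pair with th0 replaced by -(th0 + 1)
([riccati_dual]); this is where the shift by 1 comes from, since
D (t^2) = 2 t^2.  As only th0^2 enters degP_V, qt solves
degP_V(th0 + 1, th1), and the last display is the formula for the new a
([shift_a_riccati]).

The symmetries t -> -t and (t, q) -> (i t, 1 - q) are affine changes of
variables, which act on first and second derivatives by constants
([degPV_solution_affine]). *)

(** * Complex differentiation *)

(** Pinning the types to [C] lets the rules below be stated with complex
arithmetic instead of the operations of a normed module. *)
Definition is_C_derive (f : C -> C) (z l : C) : Prop :=
  @is_derive C_AbsRing C_NormedModule f z l.

(** [C] carries two normed module structures over itself, whose uniform
structures come from the balls of the real plane and from the modulus.  The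
norms agree, hence so do the derivatives; the product and chain rules refer to
the second one. *)
Lemma is_C_derive_absring (f : C -> C) (z l : C) :
  is_C_derive f z l <->
  @is_derive C_AbsRing (AbsRing_NormedModule C_AbsRing) f z l.
Proof.
  split; intros [[Hp Hs Hn] Hd]; (split; [constructor |]); assumption.
Qed.

Lemma is_C_derive_eq (f : C -> C) (z l l' : C) :
  is_C_derive f z l -> l = l' -> is_C_derive f z l'.
Proof. now intros H <-. Qed.

Lemma is_C_derive_const (c z : C) : is_C_derive (fun _ => c) z 0.
Proof. exact (is_derive_const (V := C_NormedModule) c z). Qed.

Lemma is_C_derive_id (z : C) : is_C_derive (fun t => t) z 1.
Proof. apply is_C_derive_absring. exact (is_derive_id z). Qed.

Lemma is_C_derive_plus (f g : C -> C) (z df dg : C) :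
  is_C_derive f z df -> is_C_derive g z dg ->
  is_C_derive (fun t => f t + g t) z (df + dg).
Proof. exact (is_derive_plus (V := C_NormedModule) f g z df dg). Qed.

Lemma is_C_derive_opp (f : C -> C) (z df : C) :
  is_C_derive f z df -> is_C_derive (fun t => - f t) z (- df).
Proof. exact (is_derive_opp (V := C_NormedModule) f z df). Qed.

Lemma is_C_derive_minus (f g : C -> C) (z df dg : C) :
  is_C_derive f z df -> is_C_derive g z dg ->
  is_C_derive (fun t => f t - g t) z (df - dg).
Proof. exact (is_derive_minus (V := C_NormedModule) f g z df dg). Qed.

Lemma is_C_derive_mult (f g : C -> C) (z df dg : C) :
  is_C_derive f z df -> is_C_derive g z dg ->
  is_C_derive (fun t => f t * g t) z (df * g z + f z * dg).
Proof.
  intros Hf%is_C_derive_absring Hg%is_C_derive_absring.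
  apply is_C_derive_absring.
  exact (is_derive_mult (K := C_AbsRing) f g z df dg Hf Hg Cmult_comm).
Qed.

Lemma is_C_derive_comp (f g : C -> C) (z df dg : C) :
  is_C_derive f (g z) df -> is_C_derive g z dg ->
  is_C_derive (fun t => f (g t)) z (dg * df).
Proof.
  intros Hf Hg%is_C_derive_absring.
  exact (is_derive_comp (V := C_NormedModule) f g z df dg Hf Hg).
Qed.

(** 1/y - 1/z + (y - z)/z^2 = (y - z)^2 / (z^2 y), and |y| > |z|/2 near z. *)
Lemma is_C_derive_Cinv (z : C) : z <> 0 -> is_C_derive Cinv z (- / z ^ 2).
Proof.
  intros Hz.
  split; [apply is_linear_scal_l |].
  intros x Hx eps.
  assert (Hxz : z = x).
  { exact (is_filter_lim_locally_unique
             (V := AbsRing_NormedModule C_AbsRing) z x Hx). }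
  subst x.
  pose proof (Cmod_gt_0 z) as [Hm _]. specialize (Hm Hz).
  assert (Hd : (0 < Rmin (Cmod z / 2) (eps * Cmod z ^ 3 / 2))%R).
  { apply Rmin_pos; [lra |].
    apply Rmult_lt_0_compat; [| lra].
    apply Rmult_lt_0_compat; [apply cond_pos | now apply pow_lt]. }
  exists (mkposreal _ Hd). intros y Hy.
  (* Numerals for y need the carrier to be visibly C. *)
  change C in (type of y).
  change (Cmod (y - z) < Rmin (Cmod z / 2) (eps * Cmod z ^ 3 / 2))%R in Hy.
  change (Cmod (/ y - / z - (y - z) * - / z ^ 2) <= eps * Cmod (y - z))%R.
  assert (Hy1 : (Cmod (y - z) < Cmod z / 2)%R)
    by (eapply Rlt_le_trans; [exact Hy | apply Rmin_l]).
  assert (Hy2 : (Cmod (y - z) < eps * Cmod z ^ 3 / 2)%R)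
    by (eapply Rlt_le_trans; [exact Hy | apply Rmin_r]).
  assert (Hyz : (Cmod z / 2 < Cmod y)%R).
  { assert (Ht := Cmod_triangle y (- (y - z))).
    rewrite Cmod_opp in Ht.
    replace (y + - (y - z)) with z in Ht by ring. lra. }
  assert (Hy0 : y <> 0) by (apply Cmod_gt_0; lra).
  replace (/ y - / z - (y - z) * - / z ^ 2)
    with ((y - z) * (y - z) / (z * z * y)) by (field; now split).
  rewrite Cmod_div by (repeat apply Cmult_neq_0; assumption).
  rewrite !Cmod_mult.
  set (d := Cmod (y - z)) in *. set (m := Cmod z) in *. set (n := Cmod y) in *.
  assert (Hd0 : (0 <= d)%R) by apply Cmod_ge_0.
  apply Rle_div_l; [repeat apply Rmult_lt_0_compat; lra |].
  pose proof (cond_pos eps) as He.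
  apply Rle_trans with (d * (eps * m ^ 3 / 2))%R.
  - apply Rmult_le_compat_l; lra.
  - replace (eps * d * (m * m * n))%R with (d * (eps * (m * m) * n))%R by ring.
    apply Rmult_le_compat_l; [lra |].
    assert (0 < eps * (m * m))%R by (apply Rmult_lt_0_compat; nra).
    nra.
Qed.

Lemma is_C_derive_div (f g : C -> C) (z df dg : C) :
  is_C_derive f z df -> is_C_derive g z dg -> g z <> 0 ->
  is_C_derive (fun t => f t / g t) z ((df * g z - f z * dg) / g z ^ 2).
Proof.
  intros Hf Hg Hz.
  eapply is_C_derive_eq.
  - apply is_C_derive_mult; [exact Hf |].
    apply (is_C_derive_comp Cinv g); [now apply is_C_derive_Cinv | exact Hg].
  - cbv beta. field. exact Hz.
Qed.

(** This is what allows a formula for [C_derive q] known only on [U] to be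
differentiated again. *)
Lemma is_C_derive_ext_open (U : C -> Prop) (f g : C -> C) (z l : C) :
  open (T := C_UniformSpace) U -> U z -> (forall t, U t -> f t = g t) ->
  is_C_derive f z l -> is_C_derive g z l.
Proof.
  intros HU Hz Hfg. apply is_derive_ext_loc.
  apply locally_C. generalize (HU z Hz). now apply filter_imp.
Qed.

Lemma ex_C_derive_continuous (f : C -> C) (z : C) :
  ex_C_derive f z -> continuous (T := C_UniformSpace) (U := C_UniformSpace) f z.
Proof.
  intros H P HP. apply locally_C.
  exact (ex_derive_continuous (V := C_NormedModule) f z H P HP).
Qed.

Lemma is_C_derive_ext (f g : C -> C) (z l : C) :
  (forall t, f t = g t) -> is_C_derive f z l -> is_C_derive g z l.
Proof. exact (is_derive_ext (V := C_NormedModule) f g z l). Qed.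

Lemma is_C_derive_pow2 (f : C -> C) (z df : C) :
  is_C_derive f z df -> is_C_derive (fun t => f t ^ 2) z (2 * f z * df).
Proof.
  intros Hf. apply (is_C_derive_ext (fun t => f t * f t)).
  - intros t. ring.
  - eapply is_C_derive_eq; [apply is_C_derive_mult; exact Hf | cbv beta; ring].
Qed.

Lemma continuous_C_neq (f : C -> C) (z c : C) :
  continuous (T := C_UniformSpace) (U := C_UniformSpace) f z -> f z <> c ->
  locally (T := C_UniformSpace) z (fun t => f t <> c).
Proof.
  intros Hf Hz. apply (Hf (fun y => y <> c)).
  apply locally_C.
  apply Cminus_eq_contra, Cmod_gt_0 in Hz.
  exists (mkposreal _ Hz). intros y Hy ->.
  change (Cmod (c - f z) < Cmod (f z - c))%R in Hy.
  rewrite <- Cmod_opp in Hy.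
  replace (- (c - f z)) with (f z - c) in Hy by ring. lra.
Qed.

Lemma RtoC_neq_0 (r : R) : r <> 0%R -> RtoC r <> 0.
Proof. intros Hr H. now apply Hr, RtoC_inj. Qed.

(** The denominators met here are products and powers of constants and of
functions with a hypothesis that they do not vanish. *)
Ltac cnonzero :=
  cbv beta;
  lazymatch goal with
  | |- RtoC _ <> _ => apply RtoC_neq_0; lra
  | |- Cmult _ _ <> _ => apply Cmult_neq_0; cnonzero
  | |- Cpow _ _ <> _ => apply Cpow_nz; cnonzero
  | |- _ => assumption
  end.

(** Dispatching on the shape of the function keeps higher-order unification
from unfolding complex arithmetic; the leaves are looked up in the context. *)
Ltac cderive :=
  lazymatch goal with
  | |- is_C_derive (fun _ => ?c) _ _ => apply is_C_derive_const
  | |- is_C_derive (fun t => t) _ _ => apply is_C_derive_id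
  | |- is_C_derive (fun t => _ + _) _ _ => apply is_C_derive_plus; cderive
  | |- is_C_derive (fun t => _ - _) _ _ => apply is_C_derive_minus; cderive
  | |- is_C_derive (fun t => - _) _ _ => apply is_C_derive_opp; cderive
  | |- is_C_derive (fun t => _ ^ 2) _ _ => apply is_C_derive_pow2; cderive
  | |- is_C_derive (fun t => _ * _) _ _ => apply is_C_derive_mult; cderive
  | |- is_C_derive (fun t => _ / _) _ _ =>
      apply is_C_derive_div; [cderive | cderive | cnonzero]
  | |- _ => eassumption
  end.

Lemma is_C_derive_C_derive (f : C -> C) (z : C) :
  ex_C_derive f z -> is_C_derive f z (C_derive f z).
Proof. exact (C_derive_correct f z z). Qed.

(** * Symmetries of the equation *)

(** The derivatives of [f t = e * q (c * t) + d] are [e * c * q'] and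
[e * c ^ 2 * q''] at [c * t], so only an algebraic identity between the
right-hand sides remains.  The functions [f] and [g] are given up to pointwise
equality, so that [- t] can stand for [(- 1) * t]. *)
Lemma degPV_solution_affine (th0 th1 th0' th1' c e d : C) (U : C -> Prop)
    (q f g : C -> C) :
  degPV_solution th0 th1 U q ->
  (forall t, g t = c * t) -> (forall t, f t = e * q (g t) + d) ->
  (forall t x x' : C, t <> 0 -> x <> 0 -> x <> 1 ->
     e * x + d <> 0 /\ e * x + d <> 1 /\
     e * c ^ 2 * degPV_rhs th0 th1 (c * t) x x' =
       degPV_rhs th0' th1' t (e * x + d) (e * c * x')) ->
  degPV_solution th0' th1' (fun t => U (g t)) f.
Proof.
  intros [HU Hq] Hg Hf Hrhs.
  assert (Dg : forall t, is_C_derive g t c).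
  { intros t. apply is_C_derive_ext with (fun t => c * t).
    - intros s. now rewrite Hg.
    - eapply is_C_derive_eq; [cderive | cbv beta; ring]. }
  assert (Df : forall t, U (g t) -> is_C_derive f t (e * c * C_derive q (g t))).
  { intros t Ht. destruct (Hq _ Ht) as (_ & _ & _ & H1 & _).
    apply is_C_derive_ext with (fun t => e * q (g t) + d).
    - intros s. now rewrite Hf.
    - assert (H := is_C_derive_comp q g t _ _
                     (is_C_derive_C_derive _ _ H1) (Dg t)).
      eapply is_C_derive_eq; [cderive | cbv beta; ring]. }
  assert (HV : open (T := C_UniformSpace) (fun t => U (g t))).
  { apply open_comp; [| exact HU].
    intros t _. apply ex_C_derive_continuous. exists c. apply Dg. }
  split; [exact HV |].
  intros t Ht.
  destruct (Hq _ Ht) as (Ht0 & Hq0 & Hq1 & H1 & H2 & H3).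
  assert (DDf : is_C_derive (C_derive f) t
                  (e * c * (c * C_derive (C_derive q) (g t)))).
  { apply (is_C_derive_ext_open (fun t => U (g t))
             (fun t => e * c * C_derive q (g t))); try assumption.
    - intros s Hs. symmetry. now apply is_C_derive_unique, Df.
    - assert (H := is_C_derive_comp _ g t _ _
                     (is_C_derive_C_derive _ _ H2) (Dg t)).
      eapply is_C_derive_eq; [cderive | cbv beta; ring]. }
  assert (Ht' : t <> 0).
  { intros ->. apply Ht0. rewrite Hg. ring. }
  destruct (Hrhs t (q (g t)) (C_derive q (g t)) Ht' Hq0 Hq1) as (Hf0 & Hf1 & Hr).
  rewrite Hf. repeat split; try assumption.
  - eexists. now apply Df.
  - eexists. exact DDf.
  - rewrite (is_C_derive_unique _ _ _ DDf), (is_C_derive_unique _ _ _ (Df t Ht)).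
    rewrite <- Hr, H3, Hg. ring.
Qed.

(** * The equation as a pair of Riccati equations *)

(** The auxiliary variable, as a function of x = q and a = (t / 4) q'. *)
Definition riccati_w (th0 x a : C) : C := (th0 * (x - 1) - 2 * a) / x.

(** The values of q' and w' prescribed by the two Riccati equations. *)
Definition riccati_q' (th0 t x w : C) : C :=
  2 * (th0 * (x - 1) - w * x) / t.

Definition riccati_w' (th1 t x w : C) : C :=
  ((th1 ^ 2 - w ^ 2) / (x - 1) - 4 * t ^ 2 * (x - 1)) / t.

(** The definition of [w] is the first equation, solved for [w].  In the
second one, the terms of D w quadratic in [a] combine with those in
[a * th0] and [th0 ^ 2] to the square
- (2 a - th0 (q - 1))^2 / (q^2 (q - 1)) = - w^2 / (q - 1). *)
Lemma riccati_of_degPV (th0 th1 : C) (U : C -> Prop) (q : C -> C) (t : C) :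
  degPV_solution th0 th1 U q -> U t ->
  let w := fun s => riccati_w th0 (q s) (degPV_a q s) in
  is_C_derive q t (riccati_q' th0 t (q t) (w t)) /\
  is_C_derive w t (riccati_w' th1 t (q t) (w t)).
Proof.
  intros [_ Hq] Ht w.
  destruct (Hq _ Ht) as (Ht0 & Hq0 & Hq1 & H1 & H2 & H3).
  apply is_C_derive_C_derive in H1. apply is_C_derive_C_derive in H2.
  rewrite H3 in H2.
  assert (Hq1' : q t - 1 <> 0) by now apply Cminus_eq_contra.
  split.
  - eapply is_C_derive_eq; [exact H1 |].
    unfold riccati_q', w, riccati_w, degPV_a. field. now split.
  - eapply is_C_derive_eq.
    + unfold w, riccati_w, degPV_a. cderive.
    + cbv beta. unfold riccati_w', w, riccati_w, degPV_a, degPV_rhs. field.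
      now repeat split.
Qed.

(** Differentiating the first equation and eliminating w' with the second
gives degP_V, in which q' stands for its value in terms of [q] and [w]. *)
Lemma degPV_of_riccati (th0 th1 : C) (U : C -> Prop) (q w : C -> C) :
  open (T := C_UniformSpace) U ->
  (forall t, U t -> t <> 0 /\ q t <> 0 /\ q t <> 1 /\
     is_C_derive q t (riccati_q' th0 t (q t) (w t)) /\
     is_C_derive w t (riccati_w' th1 t (q t) (w t))) ->
  degPV_solution th0 th1 U q.
Proof.
  intros HU H. split; [exact HU |].
  intros t Ht. destruct (H t Ht) as (Ht0 & Hq0 & Hq1 & Dq & Dw).
  assert (Hq1' : q t - 1 <> 0) by now apply Cminus_eq_contra.
  assert (DDq : is_C_derive (C_derive q) t
                  (degPV_rhs th0 th1 t (q t) (riccati_q' th0 t (q t) (w t)))).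
  { apply (is_C_derive_ext_open U (fun s => riccati_q' th0 s (q s) (w s)));
      try assumption.
    - intros s Hs. symmetry. apply is_C_derive_unique. apply (H s Hs).
    - eapply is_C_derive_eq.
      + unfold riccati_q' at 1. cderive.
      + cbv beta. unfold degPV_rhs, riccati_q', riccati_w'. field. now repeat split. }
  repeat split; try assumption.
  - eexists. exact Dq.
  - eexists. exact DDq.
  - rewrite (is_C_derive_unique _ _ _ DDq). now rewrite (is_C_derive_unique _ _ _ Dq).
Qed.

(** * The Bäcklund transformation *)

Lemma shift_q_riccati (th0 th1 t x a : C) :
  t <> 0 -> x <> 0 -> x - 1 <> 0 ->
  shift_q th0 th1 t x a =
    1 + (th1 ^ 2 - riccati_w th0 x a ^ 2) / (4 * t ^ 2 * (x - 1)).
Proof.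
  intros. unfold shift_q, riccati_w. field. now repeat split.
Qed.

Lemma shift_a_riccati (th0 th1 t x a : C) :
  t <> 0 -> x <> 0 -> x - 1 <> 0 ->
  shift_a th0 th1 t x a =
    t / 4 * riccati_q' (- (th0 + 1)) t (shift_q th0 th1 t x a) (- riccati_w th0 x a).
Proof.
  intros. unfold shift_q, shift_a, riccati_q', riccati_w. field. now repeat split.
Qed.

Lemma degPV_solution_square (th0 th1 th0' th1' : C) (U : C -> Prop) (q : C -> C) :
  th0 ^ 2 = th0' ^ 2 -> th1 ^ 2 = th1' ^ 2 ->
  degPV_solution th0 th1 U q -> degPV_solution th0' th1' U q.
Proof.
  unfold degPV_solution, degPV_rhs. now intros -> ->.
Qed.

(** The relation defining [p] is symmetric in [q] and [p] up to the sign of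
[w].  Where [p <> 1] it can be solved for [th1 ^ 2 - w ^ 2], and then both
sides of the second equation for [(p, - w)] equal 4 t (q - p).  At a point
where [p = 1] the first equation for [p] still holds. *)
Lemma riccati_dual (th0 th1 : C) (U : C -> Prop) (q w p : C -> C) :
  open (T := C_UniformSpace) U ->
  (forall t, U t -> t <> 0 /\ q t <> 1 /\
     is_C_derive q t (riccati_q' th0 t (q t) (w t)) /\
     is_C_derive w t (riccati_w' th1 t (q t) (w t)) /\
     p t = 1 + (th1 ^ 2 - w t ^ 2) / (4 * t ^ 2 * (q t - 1))) ->
  forall t, U t ->
    is_C_derive p t (riccati_q' (- (th0 + 1)) t (p t) (- w t)) /\
    (p t <> 1 -> is_C_derive (fun s => - w s) t (riccati_w' th1 t (p t) (- w t))).
Proof.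
  intros HU H t Ht.
  destruct (H t Ht) as (Ht0 & Hq1%Cminus_eq_contra & Dq & Dw & Hp).
  split.
  - apply (is_C_derive_ext_open U
             (fun s => 1 + (th1 ^ 2 - w s ^ 2) / (4 * s ^ 2 * (q s - 1))));
      [exact HU | exact Ht | |].
    + intros s Hs. symmetry. apply (H s Hs).
    + eapply is_C_derive_eq.
      * cderive.
      * cbv beta. rewrite Hp. unfold riccati_q', riccati_w'. field. now split.
  - intros Hp1%Cminus_eq_contra.
    assert (Hw : th1 ^ 2 = w t ^ 2 + 4 * t ^ 2 * (q t - 1) * (p t - 1)).
    { rewrite Hp. field. now split. }
    eapply is_C_derive_eq; [cderive |].
    unfold riccati_w'. rewrite Hw. field. now repeat split.
Qed.

Theorem mainTheorem4 (th0 th1 : C) (U : C -> Prop) (q : C -> C)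
    (hq : degPV_solution th0 th1 U q) :
  (* (i) *)
  degPV_solution th0 th1 (fun t => U (- t)) (fun t => q (- t)) /\
  (* (ii) *)
  degPV_solution th1 th0 (fun t => U (Ci * t)) (fun t => - q (Ci * t) + 1) /\
  (* (iii) *)
  (degPV_solution (- th0) th1 U q /\ degPV_solution th0 (- th1) U q) /\
  (* (iv) *)
  (let a := degPV_a q in
   let qt := fun t => shift_q th0 th1 t (q t) (a t) in
   degPV_solution (th0 + 1) th1 (fun t => U t /\ qt t <> 0 /\ qt t <> 1) qt /\
   (forall t : C, U t ->
      ex_C_derive qt t /\ degPV_a qt t = shift_a th0 th1 t (q t) (a t))).
Proof.
  split; [| split; [| split; [split |]]].
  - apply (degPV_solution_affine th0 th1 th0 th1 (- 1) 1 0 U q _ _ hq).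
    + intros t. ring.
    + intros t. ring.
    + intros t x x' Ht Hx0 Hx1.
      replace (1 * x + 0) with x by ring.
      split; [exact Hx0 | split; [exact Hx1 |]].
      apply Cminus_eq_contra in Hx1.
      unfold degPV_rhs. field. now repeat split.
  - apply (degPV_solution_affine th0 th1 th1 th0 Ci (- 1) 1 U q _ _ hq).
    + reflexivity.
    + intros t. ring.
    + intros t x x' Ht Hx0 Hx1.
      assert (H1x0 : 1 - x <> 0) by now apply Cminus_eq_contra, not_eq_sym.
      assert (H1x1 : 1 - x <> 1).
      { intros E. apply Hx0. replace x with (1 - (1 - x)) by ring.
        rewrite E. ring. }
      replace (- 1 * x + 1) with (1 - x) by ring.
      split; [exact H1x0 | split; [exact H1x1 |]].
      apply Cminus_eq_contra in Hx1, H1x1.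
      assert (HC : Ci ^ 2 = - 1).
      { unfold Cpow. apply injective_projections; simpl; ring. }
      unfold degPV_rhs.
      replace ((Ci * t) ^ 2) with (- t ^ 2)
        by (transitivity (Ci ^ 2 * t ^ 2); [rewrite HC |]; ring).
      replace ((- 1 * Ci * x') ^ 2) with (- x' ^ 2)
        by (transitivity (Ci ^ 2 * x' ^ 2); [rewrite HC |]; ring).
      (* Make Ci occur squared in every denominator, where it can be removed. *)
      replace (x' / (Ci * t)) with (Ci * x' / (Ci ^ 2 * t))
        by (field; split; [exact Ht | apply Ci_nz]).
      rewrite HC. field. now repeat split.
  - apply (degPV_solution_square th0 th1); [ring | ring | exact hq].
  - apply (degPV_solution_square th0 th1); [ring | ring | exact hq].
  - intros a qt.
    set (w := fun t => riccati_w th0 (q t) (a t)).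
    assert (H : forall t, U t ->
      is_C_derive qt t (riccati_q' (- (th0 + 1)) t (qt t) (- w t)) /\
      (qt t <> 1 ->
       is_C_derive (fun s => - w s) t (riccati_w' th1 t (qt t) (- w t)))).
    { apply riccati_dual with q; [apply hq |].
      intros t Ht. destruct (riccati_of_degPV th0 th1 U q t hq Ht) as [Dq Dw].
      destruct hq as [_ Hq]. destruct (Hq _ Ht) as (Ht0 & Hq0 & Hq1 & _).
      split; [exact Ht0 | split; [exact Hq1 |]].
      split; [exact Dq | split; [exact Dw |]].
      exact (shift_q_riccati th0 th1 t (q t) (a t) Ht0 Hq0
               (Cminus_eq_contra _ _ Hq1)). }
    split.
    + (* The dual system carries the parameter - (th0 + 1). *)
      apply (degPV_solution_square (- (th0 + 1)) th1); [ring | reflexivity |].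
      apply degPV_of_riccati with (fun t => - w t).
      * intros t (Ht & Hqt0 & Hqt1).
        destruct (H t Ht) as [Dqt _].
        assert (Hc := ex_C_derive_continuous qt t (ex_intro _ _ Dqt)).
        destruct hq as [HU _].
        apply filter_and; [exact (HU t Ht) |].
        apply filter_and; now apply continuous_C_neq.
      * intros t (Ht & Hqt0 & Hqt1).
        destruct (H t Ht) as [Dqt Dw].
        destruct hq as [_ Hq]. destruct (Hq _ Ht) as (Ht0 & _).
        split; [exact Ht0 | split; [exact Hqt0 | split; [exact Hqt1 |]]].
        split; [exact Dqt | now apply Dw].
    + intros t Ht. destruct (H t Ht) as [Dqt _].
      destruct hq as [_ Hq]. destruct (Hq _ Ht) as (Ht0 & Hq0 & Hq1 & _).
      split; [eexists; exact Dqt |].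
      unfold degPV_a at 1. rewrite (is_C_derive_unique _ _ _ Dqt).
      symmetry. exact (shift_a_riccati th0 th1 t (q t) (a t) Ht0 Hq0
                         (Cminus_eq_contra _ _ Hq1)).
Qed.
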